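(* The provability logic $\mathsf{GL}$ is complete for finite transitive irreflexive provability models having necessitation and Löb's rule: if $A\in\mathcal L_\Box$ holds at every world of every such model, then $\mathsf{GL}\vdash A$.
   Context: $\mathsf{GL}$ is $\mathsf K$ (the smallest normal modal logic) plus $\Box A\to\Box\Box A$ and $\Box(\Box A\to A)\to\Box A$. Language $\mathcal L_\Box$: formulas built from atomic propositions and $\bot$ using $\to$ and a unary $\Box$. A formula is purely modal if it is a Boolean combination of formulas $\Box B$. A theory is a pair of a set of axioms and a set of inference rules (finitely many premises, one conclusion); $\mathsf T\vdash A$ means derivability from axioms by rules. A theory is classical if modus ponens is one of its rules and all classical tautologies are derivable. A provability pre-model is $\mathcal P=(W,\sqsubset,\{L_w\}_{w\in W^\sqsubset},V)$ with $W$ nonempty, $\sqsubset$ a binary relation on $W$, $V\subseteq W\times\mathrm{atoms}$, $W^\sqsubset=\{u:\exists v\,(v\sqsubset u)\}$, and a theory $L_w$ for each $w\in W^\sqsubset$. Satisfaction: atoms via $V$, $\bot$ never holds, $\to$ classical, $\mathcal P,w\Vdash\Box A$ iff $L_u\vdash A$ for all $u$ with $w\sqsubset u$. With $\sqsubset^+$ the transitive closure, $\mathcal P,w\Vdash^+A$ iff there is $u\sqsubset w$ with $\mathcal P,v\Vdash A$ for all $v$ such that $u\sqsubset^+v$. A provability model is a pre-model in which every $L_w$ is classical and which satisfies modal completeness: for every $w\in W^\sqsubset$ and purely modal $A$, $\mathcal P,w\Vdash^+A$ implies $L_w\vdash A$. Necessitation: every $L_w$ has the rule ''from $A$ infer $\Box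 A$''; Löb's rule: every $L_w$ has the rule ''from $\Box A\to A$ infer $A$''. *)

(* Defs.v *)
From Stdlib Require Import List Relations FinFun.
Import ListNotations.

Inductive form (Atom : Type) : Type :=
| Var (p : Atom)
| Bot
| Imp (A B : form Atom)
| Box (A : form Atom).

Arguments Var {Atom} p.
Arguments Bot {Atom}.
Arguments Imp {Atom} A B.
Arguments Box {Atom} A.

Declare Scope modal_scope.
Delimit Scope modal_scope with modal.
Bind Scope modal_scope with form.
Notation "A ⇒ B" := (Imp A B) (at level 55, right associativity) : modal_scope.
Notation "□ A" := (Box A) (at level 35, right associativity) : modal_scope.
Open Scope modal_scope.

(* Boxed formulas count as propositional atoms here, so [tautology] covers all
   substitution instances of propositional tautologies in the modal language. *)
Fixpoint eval {Atom : Type} (v : form Atom -> bool) (A : form Atom) : bool :=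
  match A with
  | Var _ | Box _ => v A
  | Bot => false
  | Imp B C => implb (eval v B) (eval v C)
  end.

Definition tautology {Atom : Type} (A : form Atom) : Prop :=
  forall v : form Atom -> bool, eval v A = true.

Inductive purely_modal {Atom : Type} : form Atom -> Prop :=
| pm_box B : purely_modal (□ B)
| pm_bot : purely_modal Bot
| pm_imp B C : purely_modal B -> purely_modal C -> purely_modal (B ⇒ C).

(* A rule is a list of premises with a conclusion; a schematic rule such as
   modus ponens is the set of all its instances. *)
Record theory (Atom : Type) : Type := Theory {
  axioms : form Atom -> Prop;
  rules : list (form Atom) -> form Atom -> Prop
}.

Arguments Theory {Atom} axioms rules.
Arguments axioms {Atom} t _.
Arguments rules {Atom} t _ _.

Inductive derivable {Atom : Type} (T : theory Atom) : form Atom -> Prop :=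
| der_axiom A : axioms T A -> derivable T A
| der_rule premises A :
    rules T premises A ->
    (forall B, In B premises -> derivable T B) ->
    derivable T A.

Notation "T ⊢ A" := (derivable T A) (at level 70, no associativity) : type_scope.

Definition has_modus_ponens {Atom : Type} (T : theory Atom) : Prop :=
  forall A B, rules T [A; A ⇒ B] B.

Definition has_necessitation {Atom : Type} (T : theory Atom) : Prop :=
  forall A, rules T [A] (□ A).

Definition has_loeb_rule {Atom : Type} (T : theory Atom) : Prop :=
  forall A, rules T [□ A ⇒ A] A.

Definition classical {Atom : Type} (T : theory Atom) : Prop :=
  has_modus_ponens T /\ forall A, tautology A -> T ⊢ A.

Inductive GL_axiom {Atom : Type} : form Atom -> Prop :=
| GL_taut A : tautology A -> GL_axiom A
| GL_K A B : GL_axiom (□ (A ⇒ B) ⇒ □ A ⇒ □ B)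
| GL_4 A : GL_axiom (□ A ⇒ □ □ A)
| GL_L A : GL_axiom (□ (□ A ⇒ A) ⇒ □ A).

Inductive GL_rule {Atom : Type} : list (form Atom) -> form Atom -> Prop :=
| GL_mp A B : GL_rule [A; A ⇒ B] B
| GL_nec A : GL_rule [A] (□ A).

(* All axioms are schemata, so closure under uniform substitution is automatic. *)
Definition GL (Atom : Type) : theory Atom := Theory GL_axiom GL_rule.

(* [th w] stands for L_w. It is a total function, but its values outside
   [has_pred] (the set W^⊏) are never used below. *)
Record premodel (Atom : Type) : Type := Premodel {
  world : Type;
  world_inhabited : inhabited world;
  acc : world -> world -> Prop;
  th : world -> theory Atom;
  val : world -> Atom -> Prop
}.

Arguments world {Atom} p.
Arguments world_inhabited {Atom} p.
Arguments acc {Atom} p _ _.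
Arguments th {Atom} p _.
Arguments val {Atom} p _ _.

Definition has_pred {Atom : Type} (P : premodel Atom) (u : world P) : Prop :=
  exists v, acc P v u.

Fixpoint sat {Atom : Type} (P : premodel Atom) (w : world P) (A : form Atom)
  : Prop :=
  match A with
  | Var p => val P w p
  | Bot => False
  | Imp B C => sat P w B -> sat P w C
  | Box B => forall u, acc P w u -> th P u ⊢ B
  end.

Definition sat_plus {Atom : Type} (P : premodel Atom) (w : world P)
    (A : form Atom) : Prop :=
  exists u, acc P u w /\
    forall v, clos_trans (world P) (acc P) u v -> sat P v A.

Definition modally_complete {Atom : Type} (P : premodel Atom) : Prop :=
  forall w, has_pred P w -> forall A, purely_modal A ->
    sat_plus P w A -> th P w ⊢ A.

Definition provability_model {Atom : Type} (P : premodel Atom) : Prop :=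
  (forall w, has_pred P w -> classical (th P w)) /\ modally_complete P.

Definition model_necessitation {Atom : Type} (P : premodel Atom) : Prop :=
  forall w, has_pred P w -> has_necessitation (th P w).

Definition model_loeb_rule {Atom : Type} (P : premodel Atom) : Prop :=
  forall w, has_pred P w -> has_loeb_rule (th P w).

Definition finite_model {Atom : Type} (P : premodel Atom) : Prop :=
  Finite (world P).

Definition transitive_model {Atom : Type} (P : premodel Atom) : Prop :=
  transitive (world P) (acc P).

Definition irreflexive_model {Atom : Type} (P : premodel Atom) : Prop :=
  forall w, ~ acc P w w.

(* Main.v *)
From Stdlib Require Import List Relations FinFun Lia Bool Classical ClassicalEpsilon.
Require Import Defs.
Import ListNotations.

(** A finite transitive irreflexive Kripke model becomes a provability model
    with the same satisfaction relation by letting [L_w] derive exactly the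
    formulas forced at [w] and at all successors of [w]; necessitation is then
    transitivity, and Löb's rule is converse well-foundedness. It remains to
    refute a non-theorem of GL in such a Kripke model. Its worlds are the
    GL-consistent choices of [B] or [B ⇒ Bot] for each subformula [B], and
    [y] is a successor of [x] when [□ B] in [x] puts [B] and [□ B] in [y] and
    [y] contains some [□ C] whose negation is in [x]. *)

(** * Provability models from transitive Kripke models *)

Section KripkeToProvability.

Context {Atom W : Type} (R : W -> W -> Prop) (V : W -> Atom -> Prop).

Fixpoint forces (w : W) (A : form Atom) : Prop :=
  match A with
  | Var p => V w p
  | Bot => False
  | Imp B C => forces w B -> forces w C
  | Box B => forall u, R w u -> forces u B
  end.

Definition forces_up (w : W) (A : form Atom) : Prop :=
  forces w A /\ forall v, R w v -> forces v A.

Definition kripke_theory (w : W) : theory Atom :=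
  Theory (forces_up w)
    (fun premises A => (forall B, In B premises -> forces_up w B) -> forces_up w A).

Lemma derivable_kripke_theory w A : kripke_theory w ⊢ A <-> forces_up w A.
Proof.
  split.
  - induction 1 as [A HA | premises A Hr _ IH]; [exact HA | exact (Hr IH)].
  - exact (der_axiom (kripke_theory w) A).
Qed.

Definition kripke_premodel (w0 : W) : premodel Atom :=
  Premodel Atom W (inhabits w0) R kripke_theory V.

(** Forcing at [w] is a Boolean valuation with boxed formulas as atoms; excluded middle makes it
    [bool]-valued. *)
Lemma forces_tautology w A : tautology A -> forces w A.
Proof.
  intros HA.
  set (v := fun B => if excluded_middle_informative (forces w B) then true else false).
  assert (Hv : forall B, v B = true <-> forces w B).
  { intros B. unfold v. now destruct (excluded_middle_informative (forces w B)). }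
  assert (He : forall B, eval v B = true <-> forces w B).
  { induction B as [p | | B IHB C IHC | B _]; try apply Hv; simpl; [easy |].
    rewrite <- IHB, <- IHC. now destruct (eval v B), (eval v C); simpl; intuition. }
  apply He, HA.
Qed.

Hypothesis R_trans : transitive W R.

(** In the box case, derivability at a successor [u] of [w] also demands truth at the successors of
    [u]; by transitivity these are successors of [w] already. *)
Lemma sat_kripke_premodel w0 A :
  forall w, sat (kripke_premodel w0) w A <-> forces w A.
Proof.
  induction A as [p | | B IHB C IHC | B IHB]; intros w; simpl.
  - easy.
  - easy.
  - now rewrite IHB, IHC.
  - split; intros H u Hu.
    + now apply derivable_kripke_theory, H.
    + apply derivable_kripke_theory. split; [now apply H |].
      intros v Hv. exact (H v (R_trans _ _ _ Hu Hv)).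
Qed.

Lemma kripke_provability_model w0 : provability_model (kripke_premodel w0).
Proof.
  split.
  - intros w _. split.
    + intros A B H.
      destruct (H A) as [HA HA']; [now left |].
      destruct (H (A ⇒ B)) as [HAB HAB']; [now right; left |].
      split; [now apply HAB |]. intros v Hv. now apply HAB', HA'.
    + intros A HA. apply derivable_kripke_theory.
      split; intros; now apply forces_tautology.
  (* The world [u] sees [w] and, by transitivity, every successor of [w], so truth above [u] gives
     [forces_up w A]. *)
  - intros w _ A _ [u [Huw Hu]]. apply derivable_kripke_theory. split.
    + apply (sat_kripke_premodel w0), Hu. now apply t_step.
    + intros v Hv. apply (sat_kripke_premodel w0), Hu.
      now apply t_step, (R_trans _ w).
Qed.

Lemma kripke_necessitation w0 : model_necessitation (kripke_premodel w0).
Proof.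
  intros w _ A H. destruct (H A) as [HA HA']; [now left |].
  split; [exact HA' |]. intros v Hv u Hu. now apply HA', (R_trans _ v).
Qed.

Lemma kripke_loeb_rule w0 :
  well_founded (fun u v => R v u) -> model_loeb_rule (kripke_premodel w0).
Proof.
  intros Hwf w _ A H. destruct (H (□ A ⇒ A)) as [HA HA']; [now left |].
  (* Induction from the top: successors of [v] are successors of [w], so they force [A], and
     [□ A ⇒ A] at [v] yields [A]. *)
  assert (Hup : forall v, R w v -> forces v A).
  { intros v. induction (Hwf v) as [v _ IH]. intros Hv.
    apply (HA' v Hv). intros u Hu. apply IH; [exact Hu |].
    exact (R_trans _ _ _ Hv Hu). }
  split; [exact (HA Hup) | exact Hup].
Qed.

(** Induction on the length of a list containing all successors of [w]. For a successor [v],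
    transitivity keeps the successors of [v] in that list and irreflexivity makes them differ from
    [v], which can be deleted. *)
Lemma finite_converse_well_founded :
  Finite W -> (forall w, ~ R w w) -> well_founded (fun u v => R v u).
Proof.
  intros [l Hl] Hirr w.
  assert (H : forall n l w, length l <= n -> (forall v, R w v -> In v l) ->
                       Acc (fun u v => R v u) w).
  { clear l Hl w. induction n as [| n IH]; intros l w Hn Hsucc; constructor;
      intros v Hv; destruct (in_split _ _ (Hsucc v Hv)) as [l1 [l2 ->]];
      rewrite length_app in Hn; simpl in Hn; [lia |].
    apply (IH (l1 ++ l2)); [rewrite length_app; lia |].
    intros u Hu. specialize (Hsucc u (R_trans _ _ _ Hv Hu)).
    rewrite in_app_iff in *. simpl in Hsucc.
    destruct Hsucc as [? | [-> | ?]]; [now left | | now right].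
    now destruct (Hirr u). }
  apply (H (length l) l); [easy | intros; apply Hl].
Qed.

End KripkeToProvability.

(** * Entailment from finite contexts in GL *)

Section Entailment.

Context {Atom : Type}.
Implicit Types (A B C : form Atom) (Γ Δ : list (form Atom)).

(** The context is a chain of antecedents of a GL theorem, so necessitation never applies to
    hypotheses. *)
Definition entails Γ A : Prop := GL Atom ⊢ fold_right Imp A Γ.

Lemma eval_fold_imp (v : form Atom -> bool) Γ A :
  eval v (fold_right Imp A Γ) = true <->
  ((forall B, In B Γ -> eval v B = true) -> eval v A = true).
Proof.
  induction Γ as [| B Γ IH]; simpl.
  - intuition.
  - rewrite implb_true_iff, IH. split; intros H.
    + intros HΓ. apply H; auto.
    + intros HB HΓ. apply H. intros C [<- | HC]; auto.
Qed.

Lemma GL_modus_ponens A B : GL Atom ⊢ A -> GL Atom ⊢ A ⇒ B -> GL Atom ⊢ B.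
Proof.
  intros HA HAB. apply (der_rule (GL Atom) [A; A ⇒ B]); [constructor |].
  intros C [<- | [<- | []]]; assumption.
Qed.

Lemma GL_necessitation A : GL Atom ⊢ A -> GL Atom ⊢ □ A.
Proof.
  intros HA. apply (der_rule (GL Atom) [A]); [constructor |].
  now intros C [<- | []].
Qed.

Lemma GL_modus_ponens_list Δ A :
  (forall B, In B Δ -> GL Atom ⊢ B) -> GL Atom ⊢ fold_right Imp A Δ -> GL Atom ⊢ A.
Proof.
  induction Δ as [| B Δ IH]; simpl; intros HΔ H; [exact H |].
  apply IH; [auto |]. apply (GL_modus_ponens B); auto.
Qed.

(* Propositional consequence is checked by truth tables rather than derived. *)
Lemma entails_semantic Δ Γ A :
  (forall B, In B Δ -> entails Γ B) ->
  (forall v : form Atom -> bool,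
     (forall B, In B Γ -> eval v B = true) ->
     (forall B, In B Δ -> eval v B = true) -> eval v A = true) ->
  entails Γ A.
Proof.
  intros HΔ Hv. unfold entails.
  apply (GL_modus_ponens_list (map (fun B => fold_right Imp B Γ) Δ)).
  - intros C HC. apply in_map_iff in HC as [B [<- HB]]. now apply HΔ.
  - apply der_axiom, GL_taut. intros v. rewrite !eval_fold_imp. intros H HΓ.
    apply Hv; [exact HΓ |]. intros B HB.
    assert (HB' : eval v (fold_right Imp B Γ) = true).
    { apply H, in_map_iff. now exists B. }
    rewrite eval_fold_imp in HB'. auto.
Qed.

Lemma entails_hyp Γ A : In A Γ -> entails Γ A.
Proof. intros HA. apply (entails_semantic []); [easy | auto]. Qed.

Lemma entails_theorem Γ A : GL Atom ⊢ A -> entails Γ A.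
Proof.
  intros HA. apply (GL_modus_ponens A); [exact HA |].
  apply der_axiom, GL_taut. intros v. simpl. rewrite implb_true_iff, eval_fold_imp.
  auto.
Qed.

Lemma entails_mp Γ A B : entails Γ A -> entails Γ (A ⇒ B) -> entails Γ B.
Proof.
  intros HA HAB. apply (entails_semantic [A; A ⇒ B]).
  - now intros C [<- | [<- | []]].
  - intros v _ H. pose proof (H A (or_introl eq_refl)) as H1.
    pose proof (H (A ⇒ B) (or_intror (or_introl eq_refl))) as H2.
    simpl in H2. now rewrite H1 in H2.
Qed.

Lemma entails_deduction Γ A B : entails (A :: Γ) B -> entails Γ (A ⇒ B).
Proof.
  intros H. apply (GL_modus_ponens _ _ H), der_axiom, GL_taut. intros v.
  change (implb (eval v (fold_right Imp B (A :: Γ)))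
            (eval v (fold_right Imp (A ⇒ B) Γ)) = true).
  rewrite implb_true_iff, !eval_fold_imp. simpl. rewrite implb_true_iff.
  intros HB HΓ HA. apply HB. intros C [<- | HC]; auto.
Qed.

Lemma entails_cut Γ Δ A :
  (forall B, In B Δ -> entails Γ B) -> entails Δ A -> entails Γ A.
Proof.
  intros HΔ HA. apply (entails_semantic (fold_right Imp A Δ :: Δ)).
  - intros B [<- | HB]; [now apply entails_theorem | auto].
  - intros v _ H. assert (H' := H _ (or_introl eq_refl)).
    rewrite eval_fold_imp in H'. apply H'. intros B HB. apply H. now right.
Qed.

Lemma entails_incl Γ Δ A : incl Γ Δ -> entails Γ A -> entails Δ A.
Proof. intros Hi. apply entails_cut. intros B HB. now apply entails_hyp, Hi. Qed.

(** Necessitation boxes the whole iterated implication; K then moves the box inwards past one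
    antecedent at a time. *)
Lemma entails_box Γ A : entails Γ A -> entails (map Box Γ) (□ A).
Proof.
  intros H. apply GL_necessitation, (entails_theorem (map Box Γ)) in H.
  (* The context becomes a fixed [Δ] including [map Box Γ], so that it does not shrink with [Γ] in
     the induction. *)
  revert H. generalize (incl_refl (map Box Γ)).
  generalize (map Box Γ) at 2 3 4 as Δ.
  induction Γ as [| B Γ IH]; simpl; intros Δ Hi H; [exact H |].
  apply IH; [intros C HC; apply Hi; now right |].
  apply (entails_mp Δ (□ B)); [apply entails_hyp, Hi; now left |].
  apply (entails_mp Δ _ _ H), entails_theorem, der_axiom, GL_K.
Qed.

Definition consistent Γ : Prop := ~ entails Γ Bot.

Lemma entails_by_contradiction Γ A : entails ((A ⇒ Bot) :: Γ) Bot -> entails Γ A.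
Proof.
  intros H. apply entails_deduction in H.
  apply (entails_semantic [(A ⇒ Bot) ⇒ Bot]); [now intros C [<- | []] |].
  intros v _ Hv. specialize (Hv _ (or_introl eq_refl)). simpl in Hv.
  now destruct (eval v A).
Qed.

Lemma consistent_extend Γ A :
  consistent Γ -> consistent (A :: Γ) \/ consistent ((A ⇒ Bot) :: Γ).
Proof.
  intros HΓ. apply not_and_or. intros [H1 H2]. apply HΓ.
  apply (entails_mp Γ A).
  - now apply entails_by_contradiction.
  - now apply entails_deduction.
Qed.

Lemma consistent_incl Γ Δ : incl Γ Δ -> consistent Δ -> consistent Γ.
Proof. intros Hi HΔ H. now apply HΔ, (entails_incl Γ). Qed.

Lemma consistent_neg Γ A : consistent Γ -> In A Γ -> In (A ⇒ Bot) Γ -> False.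
Proof.
  intros HΓ H1 H2. apply HΓ, (entails_mp Γ A); now apply entails_hyp.
Qed.

(* Löb's axiom: the consistency of [□ B] along with [B ⇒ Bot] is what makes the
   canonical accessibility relation irreflexive. *)
Lemma consistent_successor Γ Δ B :
  (forall C, In C Δ -> In (□ C) Γ) -> consistent Γ -> In (□ B ⇒ Bot) Γ ->
  consistent ((B ⇒ Bot) :: □ B :: Δ ++ map Box Δ).
Proof.
  intros HΔ HΓ HB H. apply HΓ, (entails_mp Γ (□ B)); [| now apply entails_hyp].
  apply entails_by_contradiction, entails_deduction, entails_box in H.
  apply (entails_mp Γ (□ (□ B ⇒ B))).
  - revert H. apply entails_cut. intros C HC.
    rewrite map_app, in_app_iff in HC. destruct HC as [HC | HC].
    + apply in_map_iff in HC as [D [<- HD]]. now apply entails_hyp, HΔ.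
    + apply in_map_iff in HC as [D [<- HD]].
      apply in_map_iff in HD as [E [<- HE]].
      apply (entails_mp Γ (□ E)); [now apply entails_hyp, HΔ |].
      apply entails_theorem, der_axiom, GL_4.
  - apply entails_theorem, der_axiom, GL_L.
Qed.

End Entailment.

(** * Canonical Kripke model over the subformulas *)

Section CanonicalModel.

Context {Atom : Type}.
Implicit Types (A B C : form Atom) (Γ l : list (form Atom)).

(** One sign per entry of [l]. Repeated entries get independent signs; consistency of the literals
    rules out a clash. *)
Definition choice l : Type := fold_right (fun _ T => bool * T)%type unit l.

Lemma choice_finite l : Finite (choice l).
Proof.
  induction l as [| A l [L HL]].
  - exists [tt]. intros []. now left.
  - exists (list_prod [true; false] L). intros [b x]. apply in_prod.
    + destruct b; simpl; auto.
    + apply HL.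
Qed.

Fixpoint literals l : choice l -> list (form Atom) :=
  match l with
  | [] => fun _ => []
  | A :: l => fun x => (if fst x then A else A ⇒ Bot) :: literals l (snd x)
  end.

Lemma literals_total l (x : choice l) A :
  In A l -> In A (literals l x) \/ In (A ⇒ Bot) (literals l x).
Proof.
  induction l as [| B l IH]; simpl; [easy |]. destruct x as [b x]; simpl.
  intros [<- | HA].
  - destruct b; auto.
  - destruct (IH x HA); auto.
Qed.

Lemma lindenbaum l Γ :
  consistent Γ -> exists x : choice l, consistent (literals l x ++ Γ).
Proof.
  intros HΓ. induction l as [| A l [x Hx]]; [now exists tt |].
  destruct (consistent_extend _ A Hx) as [H | H].
  - now exists (true, x).
  - now exists (false, x).
Qed.

Fixpoint subformulas A : list (form Atom) :=
  A :: match A with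
       | Imp B C => subformulas B ++ subformulas C
       | Box B => subformulas B
       | _ => []
       end.

Lemma subformulas_self A : In A (subformulas A).
Proof. destruct A; now left. Qed.

Lemma subformulas_trans A B : In B (subformulas A) -> incl (subformulas B) (subformulas A).
Proof.
  induction A as [p | | A1 IH1 A2 IH2 | A1 IH]; intros [<- | H];
    try apply incl_refl; try easy; apply incl_tl.
  - apply in_app_iff in H as [H | H]; [apply incl_appl | apply incl_appr]; auto.
  - auto.
Qed.

Variable A0 : form Atom.
Notation l0 := (subformulas A0).
Notation member x A := (In A (literals l0 x)).

(* Inconsistent choices stay in the type of worlds, which is thus trivially
   finite, but no world accesses them. *)
Definition canonical_acc (x y : choice l0) : Prop :=
  consistent (literals l0 y) /\
  (forall B, member x (□ B) -> In (□ B) l0 -> member y B /\ member y (□ B)) /\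
  exists C, In (□ C) l0 /\ member x (□ C ⇒ Bot) /\ member y (□ C).

Definition canonical_val (x : choice l0) (p : Atom) : Prop := member x (Var p).

Lemma canonical_acc_trans : transitive (choice l0) canonical_acc.
Proof.
  intros x y z [Hy [Hxy [C [HC [HxC HyC]]]]] [Hz [Hyz _]].
  split; [exact Hz |]. split.
  - intros B HB Hl. apply Hyz; [now apply Hxy | exact Hl].
  (* The box gained at [y] persists at [z], so the same [C] is a witness. *)
  - exists C. split; [exact HC |]. split; [exact HxC |]. now apply Hyz.
Qed.

Lemma canonical_acc_irrefl x : ~ canonical_acc x x.
Proof. intros [Hx [_ [C [_ [H1 H2]]]]]. exact (consistent_neg _ _ Hx H2 H1). Qed.

(** Equality of atoms is not assumed decidable, so the list is obtained by classical case
    distinction instead of a filter. *)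
Lemma unboxed_members l Γ :
  exists Δ, forall C, In C Δ <-> In (□ C) l /\ In (□ C) Γ.
Proof.
  induction l as [| A l [Δ HΔ]]; [now exists [] |].
  destruct (classic (exists C, A = □ C /\ In A Γ)) as [[C [-> HC]] | H].
  - exists (C :: Δ). intros D. simpl. rewrite HΔ. split.
    + intros [<- | ?]; tauto.
    + intros [[[= <-] | ?] ?]; tauto.
  - exists Δ. intros D. simpl. rewrite HΔ. split; [tauto |].
    intros [[-> | ?] ?]; [destruct H; now exists D | tauto].
Qed.

Lemma member_of_consistent (x : choice l0) Γ A :
  consistent (literals l0 x ++ Γ) -> In A l0 -> In A Γ -> member x A.
Proof.
  intros Hx Hl HA. destruct (literals_total l0 x A Hl) as [H | H]; [exact H |].
  destruct (consistent_neg _ A Hx); apply in_app_iff; auto.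
Qed.

Lemma neg_member_of_consistent (x : choice l0) Γ A :
  consistent (literals l0 x ++ Γ) -> In A l0 -> In (A ⇒ Bot) Γ -> ~ member x A.
Proof.
  intros Hx Hl HA H. apply (consistent_neg _ A Hx); apply in_app_iff; auto.
Qed.

Lemma canonical_successor (x : choice l0) B :
  consistent (literals l0 x) -> In (□ B) l0 -> ~ member x (□ B) ->
  exists y, canonical_acc x y /\ ~ member y B.
Proof.
  intros Hx Hl HB.
  assert (HnB : member x (□ B ⇒ Bot)).
  { now destruct (literals_total l0 x (□ B) Hl). }
  assert (Hsub : forall C, In (□ C) l0 -> In C l0).
  { intros C HC. apply (subformulas_trans _ _ HC). right. apply subformulas_self. }
  destruct (unboxed_members l0 (literals l0 x)) as [Δ HΔ].
  assert (HΓ : consistent ((B ⇒ Bot) :: □ B :: Δ ++ map Box Δ)).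
  { apply (consistent_successor (literals l0 x)); [| exact Hx | exact HnB].
    intros C HC. now apply HΔ. }
  (* In [y], the part [Δ ++ map Box Δ] transfers the boxes of [x], [□ B] is the newly gained box,
     and [B ⇒ Bot] keeps [B] out. *)
  destruct (lindenbaum l0 _ HΓ) as [y Hy]. exists y. split.
  - split; [| split].
    + revert Hy. apply consistent_incl. now apply incl_appl.
    + intros C HC HlC. assert (HCΔ : In C Δ) by now apply HΔ.
      split; apply (member_of_consistent _ _ _ Hy); auto; do 2 right;
        apply in_app_iff; [now left | right; now apply in_map].
    + exists B. split; [exact Hl |]. split; [exact HnB |].
      apply (member_of_consistent _ _ _ Hy); [exact Hl | now right; left].
  - apply (neg_member_of_consistent _ _ _ Hy); [now apply Hsub | now left].
Qed.

Lemma truth_lemma A :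
  In A l0 -> forall x, consistent (literals l0 x) ->
  (forces canonical_acc canonical_val x A <-> member x A).
Proof.
  induction A as [p | | B IHB C IHC | B IHB]; intros Hl x Hx; simpl.
  - easy.
  - split; [easy |]. intros H. now apply Hx, entails_hyp.
  - assert (HlB : In B l0).
    { apply (subformulas_trans _ _ Hl). right.
      apply in_app_iff. left. apply subformulas_self. }
    assert (HlC : In C l0).
    { apply (subformulas_trans _ _ Hl). right.
      apply in_app_iff. right. apply subformulas_self. }
    rewrite (IHB HlB x Hx), (IHC HlC x Hx).
    (* A consistent choice contains every subformula that it entails, since it would otherwise
       contain the negation. *)
    assert (Hmem : forall D, In D l0 -> entails (literals l0 x) D -> member x D).
    { intros D HD He. destruct (literals_total l0 x D HD) as [H | H]; [exact H |].
      destruct Hx. apply (entails_mp _ D); [exact He | now apply entails_hyp]. }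
    split.
    + intros H. apply Hmem; [exact Hl |]. apply entails_deduction.
      destruct (literals_total l0 x B HlB) as [HB | HB].
      * apply entails_hyp. right. now apply H.
      (* Here [B] is refuted in [x], so assuming [B] gives [C] by ex falso. *)
      * apply (entails_semantic [Bot]).
        -- intros D [<- | []]. apply (entails_mp _ B); apply entails_hyp; simpl; auto.
        -- intros v _ Hv. now specialize (Hv _ (or_introl eq_refl)).
    + intros H HB. apply Hmem; [exact HlC |].
      apply (entails_mp _ B); now apply entails_hyp.
  - assert (HlB : In B l0).
    { apply (subformulas_trans _ _ Hl). right. apply subformulas_self. }
    split.
    + intros H. apply NNPP. intros HB.
      destruct (canonical_successor x B Hx Hl HB) as [y [Hxy Hy]].
      apply Hy, IHB; [exact HlB | apply Hxy | now apply H].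
    + intros HB y Hxy. apply IHB; [exact HlB | apply Hxy |]. now apply Hxy.
Qed.

End CanonicalModel.

(** * Canonical countermodel to a non-theorem *)

Theorem theorem3p17 (Atom : Type) (A : form Atom) :
  (forall P : premodel Atom,
     provability_model P ->
     finite_model P -> transitive_model P -> irreflexive_model P ->
     model_necessitation P -> model_loeb_rule P ->
     forall w : world P, sat P w A) ->
  GL Atom ⊢ A.
Proof.
  intros Hvalid. apply NNPP. intros HA.
  assert (Hc : consistent [A ⇒ Bot]).
  { intros H. exact (HA (entails_by_contradiction [] A H)). }
  destruct (lindenbaum (subformulas A) _ Hc) as [x Hx].
  assert (Htrans := canonical_acc_trans A).
  assert (Hirr := canonical_acc_irrefl A).
  assert (Hfin := choice_finite (subformulas A)).
  assert (Hsat : sat (kripke_premodel (canonical_acc A) (canonical_val A) x) x A).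
  { apply Hvalid.
    - now apply kripke_provability_model.
    - exact Hfin.
    - exact Htrans.
    - exact Hirr.
    - now apply kripke_necessitation.
    - apply kripke_loeb_rule; [exact Htrans |].
      now apply finite_converse_well_founded. }
  (* Satisfaction at [x] turns into forcing and then into membership of [A] in [x], against the
     [A ⇒ Bot] that [x] was built to be consistent with. *)
  apply sat_kripke_premodel in Hsat; [| exact Htrans].
  apply truth_lemma in Hsat.
  - revert Hsat. apply (neg_member_of_consistent A x _ A Hx).
    + apply subformulas_self.
    + now left.
  - apply subformulas_self.
  - revert Hx. apply consistent_incl. now apply incl_appl.
Qed.
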